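(* For every positive integer $N$, there exists a graph with exactly $N^2+N$ vertices that contains no $K_{2,2}$ subgraph, whose twin-width is at most $3$ and whose tree-width is at least $N$.
   Context: All graphs are finite and simple (no loops, no multiple edges). ''Subgraph'' means not necessarily induced subgraph. $K_{2,2}$ is the complete bipartite graph with both sides of size $2$, i.e. the $4$-cycle. Tree-width is the usual notion (minimum over tree-decompositions of the maximum bag size minus one). Trigraph: a simple graph $G$ in which some edges are marked red (the other edges are black). ''Neighbour'' and $N_G(x)$ refer to all edges (red and black); $N^r_G(x)$ denotes the set of red neighbours of $x$, and the red degree of $x$ is $|N_G^r(x)|$. A contraction of a pair of distinct (not necessarily adjacent) vertices $x_1,x_2$ of a trigraph $G$ produces the trigraph $G'$ that is the same as $G$ except that $x_1,x_2$ are replaced by one new vertex $x_0$ with $N_{G'}(x_0)=(N_G(x_1)\cup N_G(x_2))\setminus\{x_1,x_2\}$ and $N^r_{G'}(x_0)=\big(N^r_G(x_1)\cup N^r_G(x_2)\cup (N_G(x_1)\,\Delta\, N_G(x_2))\big)\setminus\{x_1,x_2\}$, where $\Delta$ is symmetric difference. A contraction sequence of a trigraph $G$ is a sequence of successive contractions turning $G$ into a single vertex; its width is the maximum red degree of any vertex in any trigraph of the sequence. The twin-width of $G$ is the minimum width over all contraction sequences of $G$. For an ordinary graph $G$, these notions are applied to $G$ viewed as a trigraph with no red edges. *)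

(* Defs.v *)
From mathcomp Require Import all_boot.
From mathcomp Require Import boolp.

Set Implicit Arguments.
Unset Strict Implicit.
Unset Printing Implicit Defensive.

Record sgraph := SGraph {
  vertex :> finType;
  edge : rel vertex;
  edge_sym : symmetric edge;
  edge_irrefl : irreflexive edge
}.

Arguments edge {s}.

Definition nbr (G : sgraph) (x : G) : {set G} := [set y | edge x y].

(* The subgraph need not be induced: non-edges of H may be mapped to edges. *)
Definition has_subgraph (H G : sgraph) : Prop :=
  exists f : H -> G,
    injective f /\ forall x y : H, edge x y -> edge (f x) (f y).

Definition bipartite_rel (m n : nat) : rel ('I_m + 'I_n) :=
  fun u v => match u, v with
             | inl _, inr _ | inr _, inl _ => true
             | _, _ => false
             end.

Lemma bipartite_rel_sym m n : symmetric (@bipartite_rel m n).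
Proof. by case=> a [] b. Qed.

Lemma bipartite_rel_irrefl m n : irreflexive (@bipartite_rel m n).
Proof. by case. Qed.

Definition complete_bipartite (m n : nat) : sgraph :=
  SGraph (@bipartite_rel_sym m n) (@bipartite_rel_irrefl m n).

Record trigraph := Trigraph {
  underlying :> sgraph;
  red : rel underlying;
  red_sym : symmetric red;
  red_edge : subrel red edge
}.

Arguments red {t}.

Lemma no_red_sym (G : sgraph) : symmetric (fun _ _ : G => false).
Proof. by []. Qed.

Lemma no_red_edge (G : sgraph) : subrel (fun _ _ : G => false) edge.
Proof. by []. Qed.

Definition trigraph_of (G : sgraph) : trigraph :=
  Trigraph (@no_red_sym G) (@no_red_edge G).

Definition red_nbr (G : trigraph) (x : G) : {set G} := [set y | red x y].

Definition max_red_degree (G : trigraph) : nat := \max_(x : G) #|red_nbr x|.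

Section Contraction.

Variables (G : trigraph) (x1 x2 : G).

(* The vertices of G other than x1 and x2, plus the new vertex None. *)
Definition contract_vertex : finType :=
  option {z : G | (z != x1) && (z != x2)}.

Definition contract_nbr : {set G} :=
  (nbr x1 :|: nbr x2) :\: [set x1; x2].

Definition contract_red_nbr : {set G} :=
  (red_nbr x1 :|: red_nbr x2
     :|: ((nbr x1 :\: nbr x2) :|: (nbr x2 :\: nbr x1))) :\: [set x1; x2].

Definition contract_edge : rel contract_vertex :=
  fun u v => match u, v with
             | Some a, Some b => edge (val a) (val b)
             | None, Some b => val b \in contract_nbr
             | Some a, None => val a \in contract_nbr
             | None, None => false
             end.

Definition contract_red : rel contract_vertex :=
  fun u v => match u, v with
             | Some a, Some b => red (val a) (val b)
             | None, Some b => val b \in contract_red_nbr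
             | Some a, None => val a \in contract_red_nbr
             | None, None => false
             end.

Lemma contract_edge_sym : symmetric contract_edge.
Proof. by case=> [a|] [b|] //=; apply: edge_sym. Qed.

Lemma contract_edge_irrefl : irreflexive contract_edge.
Proof. by case=> [a|] //=; apply: edge_irrefl. Qed.

Lemma contract_red_sym : symmetric contract_red.
Proof. by case=> [a|] [b|] //=; apply: red_sym. Qed.

Lemma contract_red_nbr_sub : contract_red_nbr \subset contract_nbr.
Proof.
apply/subsetP=> z; rewrite !inE => /andP[-> /=].
case/orP=> [/orP[] /red_edge -> //|]; first by rewrite orbT.
by case/orP=> /andP[_ ->]; rewrite ?orbT.
Qed.

Lemma contract_red_edge : subrel contract_red contract_edge.
Proof.
case=> [a|] [b|] //=; first exact: red_edge.
  exact: (subsetP contract_red_nbr_sub).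
exact: (subsetP contract_red_nbr_sub).
Qed.

Definition contract : trigraph :=
  @Trigraph (SGraph contract_edge_sym contract_edge_irrefl)
            contract_red contract_red_sym contract_red_edge.

Lemma card_contract : x1 != x2 -> #|contract|.+1 = #|G|.
Proof.
move=> x12; rewrite card_option card_sig.
rewrite (cardD1 x1 G) (cardD1 x2 [predD1 G & x1]) !inE eq_sym x12 !add1n.
by congr _.+2; apply: eq_card => z; rewrite !inE andbT andbC.
Qed.

End Contraction.

(* The bound is #|G| <= 1 and not #|G| = 1 so that the empty graph has a
   (trivial) sequence too; the two agree on nonempty graphs. *)
Inductive contraction_seq : trigraph -> Type :=
| ContractionDone (G : trigraph) of #|G| <= 1 : contraction_seq G
| ContractionStep (G : trigraph) (x1 x2 : G) of
    x1 != x2 & contraction_seq (contract x1 x2) : contraction_seq G.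

Fixpoint seq_width (G : trigraph) (s : contraction_seq G) : nat :=
  match s with
  | ContractionDone G _ => max_red_degree G
  | ContractionStep G _ _ _ s' => maxn (max_red_degree G) (seq_width s')
  end.

Lemma contraction_seq_exists (G : trigraph) :
  exists w, `[< exists s : contraction_seq G, seq_width s = w >].
Proof.
suff [s] : inhabited (contraction_seq G).
  by exists (seq_width s); apply/asboolP; exists s.
have [n leGn] := ubnP #|G|; elim: n G leGn => // n IHn G leGn.
have [G1|/card_gt1P[x1 [x2 [_ _ x12]]]] := leqP #|G| 1.
  by constructor; apply: ContractionDone.
have [|s] := IHn (contract x1 x2); first by rewrite card_contract.
by constructor; apply: ContractionStep x12 s.
Qed.

Definition twin_width (G : trigraph) : nat :=
  ex_minn (contraction_seq_exists G).

Definition is_tree (T : sgraph) : Prop :=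
  [/\ 0 < #|T|,
      forall s t : T, connect edge s t &
      forall c : seq T, 2 < size c -> ~ ucycle edge c].

Record tree_decomposition (G : sgraph) := TreeDecomposition {
  td_tree : sgraph;
  td_treeP : is_tree td_tree;
  bag : td_tree -> {set G};
  bag_vertex : forall v : G, exists t, v \in bag t;
  bag_edge : forall u v : G, edge u v ->
    exists t, (u \in bag t) && (v \in bag t);
  bag_connected : forall (v : G) (s t : td_tree),
    v \in bag s -> v \in bag t ->
    connect [rel a b | [&& edge a b, v \in bag a & v \in bag b]] s t
}.

Definition td_width (G : sgraph) (D : tree_decomposition G) : nat :=
  (\max_(t : td_tree D) #|bag t|).-1.

Section TrivialDecomposition.

Variable G : sgraph.

Definition one_vertex_graph : sgraph :=
  @SGraph unit (fun _ _ => false) (fun _ _ => erefl) (fun _ => erefl).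

Lemma one_vertex_tree : is_tree one_vertex_graph.
Proof.
split; first by rewrite card_unit.
  by case=> [] []; apply: connect0.
by case=> [|[] [|[] c]].
Qed.

Lemma tree_decomposition_exists :
  exists w, `[< exists D : tree_decomposition G, td_width D = w >].
Proof.
have bagV (v : G) : exists t : one_vertex_graph, v \in [set: G].
  by exists tt; rewrite inE.
have bagE (u v : G) : edge u v ->
    exists t : one_vertex_graph, (u \in [set: G]) && (v \in [set: G]).
  by exists tt; rewrite !inE.
have bagC (v : G) (s t : one_vertex_graph) :
    v \in [set: G] -> v \in [set: G] ->
    connect [rel a b : one_vertex_graph |
      [&& edge a b, v \in [set: G] & v \in [set: G]]] s t.
  by case: s t => [] []; rewrite connect0.
pose D := @TreeDecomposition G _ one_vertex_tree (fun=> setT) bagV bagE bagC.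
by exists (td_width D); apply/asboolP; exists D.
Qed.

End TrivialDecomposition.

Definition tree_width (G : sgraph) : nat :=
  ex_minn (tree_decomposition_exists G).

(* Main.v *)
Require Import Defs.
From mathcomp Require Import all_boot.
From mathcomp Require Import boolp.
From mathcomp Require Import zify.

Set Implicit Arguments.
Unset Strict Implicit.
Unset Printing Implicit Defensive.

(** The graph consists of [N] disjoint paths ("rows") on [N] vertices each and
    [N] pairwise non-adjacent apexes, the [c]-th apex being joined to the [c]-th
    vertex of every row.

    Twin-width: merge the rows one after the other, from left to right.  The two
    vertices merged have the same apex neighbour, so apex edges stay black, and
    the only red edges run along the row being built, with one extra red edge at
    the merging front.  What remains is a comb, which is swallowed from one end.

    Tree-width: contracting the rows gives a [K_{N,N}] minor, whence a bramble of
    order [N + 1]: the last apex, the last row, and all unions of one of the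
    other apexes with one of the other rows.  If no bag of a tree-decomposition
    met every element of the bramble, one could orient each tree node towards an
    element it misses; following the orientation in the finite tree ends up going
    back and forth along one edge, which then separates two touching sets. *)

(** * Contraction sequences as successive mergings of label classes *)

Section Quotient.

Variables (G : sgraph) (L : eqType).
Implicit Types (c : G -> L) (H : trigraph).

Definition class_edge c (x y : G) : Prop :=
  exists x' y', [/\ c x' = c x, c y' = c y & edge x' y'].

Definition class_nonedge c (x y : G) : Prop :=
  exists x' y', [/\ c x' = c x, c y' = c y & ~~ edge x' y'].

(* A labelling [c] of [G] stands for the partition into its fibres; [H] is the
   trigraph obtained by contracting each fibre.  Only an upper bound on its red
   edges is recorded. *)
Record quotient_map c H (p : G -> H) : Prop := QuotientMap {
  quo_surj : forall h, exists x, p x == h;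
  quo_ker : forall x y, (p x == p y) = (c x == c y);
  quo_edge : forall x y,
    edge (p x) (p y) <-> c x != c y /\ class_edge c x y;
  quo_red : forall x y, red (p x) (p y) -> class_nonedge c x y
}.

(** A red edge between two classes requires both an edge and a non-edge between them. The list [s]
    may contain labels that no vertex has, which makes explicit lists easy to give. *)
Definition red_bounded k c : Prop :=
  forall x, exists2 s : seq L, size s <= k &
    forall y, c x != c y -> class_edge c x y -> class_nonedge c x y -> c y \in s.

(** All quotients are quantified over because each contraction changes the vertex type: a later
    trigraph is known only through the labelling. *)
Definition contractible k c : Prop :=
  forall H (p : G -> H), quotient_map c p ->
    exists s : contraction_seq H, seq_width s <= k.

Lemma quotient_red_degree k c H (p : G -> H) :
  quotient_map c p -> red_bounded k c -> max_red_degree H <= k.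
Proof.
move=> Hp Hc; apply/bigmax_leqP => h _.
pose q h := c (xchoose (quo_surj Hp h)).
have pq h' : p (xchoose (quo_surj Hp h')) = h'.
  by apply/eqP; apply: (xchooseP (quo_surj Hp h')).
have qI : injective q.
  by move=> a b /eqP; rewrite /q -(quo_ker Hp) !pq => /eqP.
have [s ss Hs] := Hc (xchoose (quo_surj Hp h)).
apply: (leq_trans _ ss); rewrite cardE -(size_map q).
apply: uniq_leq_size; first by rewrite map_inj_uniq // enum_uniq.
move=> u /mapP[g]; rewrite mem_enum inE => hg ->{u}.
have hg' : red (p (xchoose (quo_surj Hp h))) (p (xchoose (quo_surj Hp g))).
  by rewrite !pq.
have [ne ce] := (quo_edge Hp _ _).1 (red_edge hg').
exact: Hs ne ce (quo_red Hp hg').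
Qed.

Lemma contractible_const k c x0 : (forall x, c x = x0) -> contractible k c.
Proof.
move=> Hc H p Hp.
have H1 (h h' : H) : h = h'.
  have [x /eqP <-] := quo_surj Hp h; have [y /eqP <-] := quo_surj Hp h'.
  by apply/eqP; rewrite (quo_ker Hp) !Hc.
have cH : #|H| <= 1 by apply/card_le1P => h _ h'; rewrite (H1 h' h) !inE eqxx.
exists (ContractionDone cH) => /=; apply: (quotient_red_degree Hp) => x.
by exists [::] => // y; rewrite !Hc eqxx.
Qed.

(** Contracting two vertices of the quotient amounts to identifying two labels: [insub] sends both
    merged vertices to [None] and keeps all others. *)
Lemma quotient_contract c c' x1 x2 H (p : G -> H) :
    c x1 != c x2 -> (forall x, c' x = if c x == c x2 then c x1 else c x) ->
    quotient_map c p ->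
  quotient_map c' (fun x => insub (p x) : contract (p x1) (p x2)).
Proof.
move=> x12 Hc' Hp.
have kerE x y : (c' x == c' y) =
    (c x == c y) || (c x \in [:: c x1; c x2]) && (c y \in [:: c x1; c x2]).
  rewrite !Hc' !inE.
  have [->|] := eqVneq (c x) (c x2); have [->|] := eqVneq (c y) (c x2).
  - by rewrite !eqxx !orbT.
  - by rewrite orbT orbF (eq_sym _ (c y)) /=.
  - by move=> /negPf->; rewrite orbT orbF andbT.
  - move=> _ _; rewrite !orbF; apply/idP/idP => [->//|/orP[//|/andP[/eqP-> /eqP->]]//].

(* [W] holds the two labels being identified; every verification below splits on membership of
   labels in [W]. *)
pose W := [:: c x1; c x2].
have kerN x y : c y \notin W -> (c' x == c' y) = (c x == c y).
  by move=> /negPf yW; rewrite kerE yW andbF orbF.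
have kerW x y : c y \in W -> (c' x == c' y) = (c x \in W).
  move=> yW; rewrite kerE yW andbT; apply: orb_idl => /eqP->; exact: yW.
have pW x : (p x != p x1) && (p x != p x2) = (c x \notin W).
  by rewrite !inE !(quo_ker Hp) negb_or.
(* The relation [R] is arbitrary so that [CN] and [CW] serve for edges and for non-edges. *)
have CN (R : rel G) x y : c x \notin W -> c y \notin W ->
    (exists x' y', [/\ c' x' = c' x, c' y' = c' y & R x' y']) <->
    (exists x' y', [/\ c x' = c x, c y' = c y & R x' y']).
  move=> xW yW; split=> -[a [b [/eqP ax /eqP by_ Rab]]]; exists a, b; split=> //; apply/eqP.
  - by rewrite -kerN.
  - by rewrite -kerN.
  - by rewrite kerN.
  - by rewrite kerN.
have CW (R : rel G) x y : c x \in W -> c y \notin W ->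
    (exists x' y', [/\ c' x' = c' x, c' y' = c' y & R x' y']) <->
    (exists x' y', [/\ c x' = c x1, c y' = c y & R x' y']) \/
    (exists x' y', [/\ c x' = c x2, c y' = c y & R x' y']).
  move=> xW yW; split.
    case=> a [b [/eqP ax /eqP by_ Rab]].
    move: ax by_; rewrite kerW // kerN // !inE => /orP[]/eqP ax /eqP by_; [left|right];
      by exists a, b.
  case=> -[a [b [ax by_ Rab]]]; exists a, b; split=> //; apply/eqP;
    by rewrite ?(kerW _ _ xW) ?(kerN _ _ yW) ?by_ ?ax ?inE ?eqxx ?orbT.
have pSome x (xW : c x \notin W) :
    insub (p x) = Some (exist _ (p x) (etrans (pW x) xW)) :> contract (p x1) (p x2).
  by rewrite insubT ?pW // => H0; congr Some; apply: val_inj.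
have pNone x (xW : c x \in W) : insub (p x) = None :> contract (p x1) (p x2).
  by rewrite insubN // pW xW.
have Wne x y : c x \in W -> c y \notin W -> c x != c y.
  by move=> xW; apply: contra => /eqP <-.
have x1W : c x1 \in W by rewrite !inE eqxx.
have x2W : c x2 \in W by rewrite !inE eqxx orbT.
have edgeW x y : c x \in W -> c y \notin W ->
    p y \in contract_nbr (p x1) (p x2) <-> c' x != c' y /\ class_edge c' x y.
  move=> xW yW; rewrite kerN // Wne //.
  have := CW edge x y xW yW; rewrite -/(class_edge c' x y) => ->.
  have -> : (p y \in contract_nbr (p x1) (p x2)) =
      edge (p x1) (p y) || edge (p x2) (p y).
    by rewrite !inE negb_or pW yW.
  split.
    by move=> /orP[] /(quo_edge Hp)[_ ?]; split=> //; [left|right].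
  by case=> _ [] ?; apply/orP; [left|right]; apply/(quo_edge Hp); split=> //; apply: Wne.
have redW x y : c x \in W -> c y \notin W ->
    p y \in contract_red_nbr (p x1) (p x2) -> class_nonedge c' x y.
  move=> xW yW Hr; apply/(CW (fun a b => ~~ edge a b)) => //.
  (* A new red edge comes from the symmetric difference, so one of the two merged classes has no
     edge at all to the class of [y]. *)
  have N z : c z \in W -> ~~ edge (p z) (p y) -> class_nonedge c z y.
    move=> zW zy; exists z, y; split=> //; apply: contra zy => zy; apply/(quo_edge Hp).
    by split; [apply: Wne|exists z, y].
  move: Hr; rewrite !inE => /andP[_ /orP[/orP[]|/orP[]/andP[+ _]]].
  - by move/(quo_red Hp); left.
  - by move/(quo_red Hp); right.
  - by move/N => H0; right; apply: H0.
  - by move/N => H0; left; apply: H0.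
have sym_edge x y : class_edge c' x y <-> class_edge c' y x.
  by split=> -[a [b [? ? ab]]]; exists b, a; rewrite edge_sym.
have sym_nonedge x y : class_nonedge c' x y -> class_nonedge c' y x.
  by case=> [a [b [? ? ab]]]; exists b, a; rewrite edge_sym.
split=> [[[h hP]|]|x y|x y|x y].
- have [x /eqP px] := quo_surj Hp h; exists x; apply/eqP.
  by subst h; rewrite insubT; congr Some; apply: val_inj.
- by exists x1; apply/eqP; apply: pNone.
- case: (boolP (c y \in W)) => yW; case: (boolP (c x \in W)) => xW.
  + by rewrite (kerW _ _ yW) xW (pNone _ xW) (pNone _ yW).
  + by rewrite (kerW _ _ yW) (negPf xW) (pSome _ xW) (pNone _ yW).
  + by rewrite (kerN _ _ yW) (negPf (Wne _ _ xW yW)) (pNone _ xW) (pSome _ yW).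
  + by rewrite (kerN _ _ yW) (pSome _ xW) (pSome _ yW) -(quo_ker Hp).
- case: (boolP (c y \in W)) => yW; case: (boolP (c x \in W)) => xW.
  + by rewrite (kerW _ _ yW) xW (pNone _ xW) (pNone _ yW); split=> // -[].
  + by rewrite (pSome _ xW) (pNone _ yW) [c' x == _]eq_sym sym_edge; apply: edgeW.
  + by rewrite (pNone _ xW) (pSome _ yW); apply: edgeW.
  + rewrite (pSome _ xW) (pSome _ yW) (kerN _ _ yW).
    have := CN edge x y xW yW; rewrite -/(class_edge c' x y) => ->.
    exact: (quo_edge Hp).
- case: (boolP (c y \in W)) => yW; case: (boolP (c x \in W)) => xW.
  + by rewrite (pNone _ xW) (pNone _ yW).
  + by rewrite (pSome _ xW) (pNone _ yW) => ?; apply/sym_nonedge/redW.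
  + by rewrite (pNone _ xW) (pSome _ yW); apply: redW.
  + rewrite (pSome _ xW) (pSome _ yW) => /(quo_red Hp) ?.
    exact/(CN (fun a b => ~~ edge a b)).
Qed.

Lemma contractible_merge k c c' x1 x2 :
    c x1 != c x2 -> (forall x, c' x = if c x == c x2 then c x1 else c x) ->
  red_bounded k c -> contractible k c' -> contractible k c.
Proof.
move=> x12 Hc' ck c'k H p Hp.
have [s sk] := c'k _ _ (quotient_contract x12 Hc' Hp).
have px : p x1 != p x2 by rewrite (quo_ker Hp).
by exists (ContractionStep px s); rewrite /= geq_max sk (quotient_red_degree Hp ck).
Qed.

Lemma twin_width_contractible k c :
  injective c -> contractible k c -> twin_width (trigraph_of G) <= k.
Proof.
move=> cI /(_ (trigraph_of G) id) [|s sk].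
  split=> [h|x y|x y|//]; first by exists h.
    by apply/eqP/eqP => [->//|/cI].
  split=> [xy|[_ [a [b [/cI-> /cI->]]]]//].
  split; last by exists x, y.
  by apply: contraTN xy => /eqP/cI ->; rewrite edge_irrefl.
rewrite /twin_width; case: ex_minnP => m _ /(_ (seq_width s)) H.
by apply: leq_trans sk; apply: H; apply/asboolP; exists s.
Qed.

End Quotient.

(** * Edges of a tree are bridges *)

Definition delete_edge (T : sgraph) (a b x y : T) : bool :=
  edge x y && ~~ ((x == a) && (y == b) || (x == b) && (y == a)).

Lemma delete_edgeC (T : sgraph) (a b : T) :
  delete_edge a b =2 delete_edge b a.
Proof. by move=> x y; rewrite /delete_edge orbC. Qed.

Lemma delete_edge_sym (T : sgraph) (a b : T) : symmetric (delete_edge a b).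
Proof.
move=> x y; rewrite /delete_edge edge_sym; congr (_ && ~~ _).
by rewrite orbC andbC; congr (_ || _); rewrite andbC.
Qed.

(** A simple path from [a] to [b] avoiding the edge would have length at least 2 and close up with
    it to a cycle. *)
Lemma tree_edge_bridge (T : sgraph) (a b : T) :
  is_tree T -> edge a b -> ~~ connect (delete_edge a b) a b.
Proof.
case=> _ _ acyc ab; apply/negP => /connectP[p0 /shortenP[p pP pU _ {p0} pb]].
have [p2|p2] := ltnP 1 (size p).
  apply: (acyc (a :: p)) => //; apply/andP; split=> //=.
  rewrite rcons_path -pb edge_sym ab andbT.
  by apply: sub_path pP => x y /andP[].
case: p pP pU pb p2 => [|y [|]] //=.
  by move=> _ _ ba; move: ab; rewrite ba edge_irrefl.
by rewrite andbT /delete_edge => /andP[_ +] _ yb; rewrite yb !eqxx.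
Qed.

Lemma connect_within_sym (G : sgraph) (B : {set G}) :
  connect_sym [rel x y | [&& edge x y, x \in B & y \in B]].
Proof.
by apply: sym_connect_sym => x y /=; rewrite edge_sym; congr andb; rewrite andbC.
Qed.

(** * Brambles and tree-decompositions *)

Section Bramble.

Variables (G : sgraph) (D : tree_decomposition G).

Definition connected_set (B : {set G}) : Prop :=
  forall u v, u \in B -> v \in B ->
    connect [rel x y | [&& edge x y, x \in B & y \in B]] u v.

Definition touching (B B' : {set G}) : Prop :=
  exists u v, [/\ u \in B, v \in B' & u = v \/ edge u v].

Lemma touching_sym B B' : touching B B' -> touching B' B.
Proof.
case=> u [v [uB vB' uv]]; exists v, u; split=> //.
by case: uv => [->|]; [left|rewrite edge_sym; right].
Qed.

Lemma touching_bag B B' : touching B B' ->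
  exists t : td_tree D, exists u v,
    [/\ u \in B, v \in B', u \in bag t & v \in bag t].
Proof.
case=> u [v [uB vB' [uv|uv]]].
  by have [t vt] := bag_vertex D v; exists t, u, v; rewrite uv -{1}uv.
by have [t /andP[]] := bag_edge D uv; exists t, u, v.
Qed.

(** The nodes whose bags meet a connected set form a subtree; if [bag t] misses the set, this
    subtree avoids [t]. *)
Lemma connected_set_avoid (B : {set G}) (t s s' : td_tree D) u u' :
    connected_set B -> [disjoint B & bag t] ->
    u \in B -> u \in bag s -> u' \in B -> u' \in bag s' ->
  connect [rel a b | [&& edge a b, a != t & b != t]] s s'.
Proof.
move=> Bc Bt uB us u'B u's'.
have avoid v r r' : v \in B -> v \in bag r -> v \in bag r' ->
    connect [rel a b | [&& edge a b, a != t & b != t]] r r'.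
  move=> vB vr vr'; have vt : v \notin bag t by rewrite (disjointFr Bt).
  apply: connect_sub (bag_connected vr vr') => a b /and3P[ab va vb].
  apply: connect1; rewrite /= ab /=.
  by apply/andP; split; apply: contraNneq vt => <-.
have /connectP[p pP u'E] := Bc u u' uB u'B; rewrite {}u'E in u's' {u'B}.
elim: p u s uB us pP u's' => [|w p IH] u s uB us /= => [_|].
  exact: avoid uB us.
case/andP=> /and3P[uw _ wB] pP ps'.
have [r /andP[ur wr]] := bag_edge D uw.
exact: connect_trans (avoid _ _ _ uB us ur) (IH _ _ wB wr pP ps').
Qed.

Lemma bramble_bag (I : Type) (B : I -> {set G}) :
    (forall i, connected_set (B i)) -> (forall i j, touching (B i) (B j)) ->
  exists t : td_tree D, forall i, exists2 u, u \in B i & u \in bag t.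
Proof.
move=> Bc Bt; apply: contrapT => noT.
have [_ Tconn Tacyc] := td_treeP D.
(* [t'] is the first node after [t] on a path towards a bag meeting the missed set [B i]; all bags
   meeting [B i] lie on its side of the edge. *)
have step (t : td_tree D) : exists t', edge t t' /\ exists i,
    forall s u, u \in B i -> u \in bag s -> connect (delete_edge t t') t' s.
  have [i iP] : exists i, [disjoint B i & bag t].
    apply: contrapT => H; apply: noT; exists t => i.
    apply: contrapT => H'; apply: H; exists i.
    rewrite disjoint_subset; apply/subsetP => u uB; rewrite inE.
    by apply/negP => ut; apply: H'; exists u.
  (* That [B i] touches itself makes it nonempty. *)
  have [s0 [u0 [_ [u0B _ us0 _]]]] := touching_bag (Bt i i).
  have s0t : s0 != t.
    by apply: contraTneq us0 => ->; rewrite (disjointFr iP).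
  have /connectP[p0 /shortenP[p pP pU _ {p0} pE]] := Tconn t s0.
  case: p pP pU pE => [_ _ ts|t' p /=]; first by rewrite ts eqxx in s0t.
  case/andP=> tt' pP /andP[tp _] pE; exists t'; split=> //; exists i => s u uB us.
  have avoid a b : [&& edge a b, a != t & b != t] -> delete_edge t t' a b.
    by rewrite /delete_edge => /and3P[-> /negPf-> /negPf->]; rewrite andbF.
  apply: (@connect_trans _ _ s0).
    apply/connectP; exists p => //.
    have pD q x : path edge x q -> t \notin x :: q -> path (delete_edge t t') x q.
      elim: q x => //= y q IH x /andP[xy qP].
      rewrite !inE !negb_or => /and3P[tx ty tq].
      apply/andP; split; first by apply: avoid; rewrite xy ![_ == t]eq_sym tx ty.
      by apply: IH => //; rewrite inE negb_or ty.
    exact: pD.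
  apply: connect_sub (connected_set_avoid (Bc i) iP u0B us0 uB us) => a b ab.
  exact/connect1/avoid.
have [f fP] := choice step.
have [t0 _] : exists t0, t0 \in td_tree D by apply/card_gt0P; case: (td_treeP D).
(* The orbit of [t0] under [f] is eventually periodic; [y] is its first periodic point and [n - k]
   the period. *)
have [k /= kn kE] := trajectP (looping_order f t0).
set n := order f t0 in kn kE.
pose y := iter k f t0.
have nE : n = (k + (n - k).-1.+1)%N by lia.
have yE : iter (n - k) f y = y.
  by rewrite /y -iterD subnK 1?ltnW.
have yU : uniq (traject f y (n - k)).
  have := orbit_uniq f t0; rewrite /orbit -/n.
  by rewrite -{1}(subnKC (ltnW kn)) trajectD cat_uniq => /and3P[].
have yC : fcycle f (traject f y (n - k)).
  have : 0 < n - k by rewrite subn_gt0.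
  move: yE; case: (n - k) => // m /= yE _.
  have -> : rcons (traject f (f y) m) y = traject f (f y) m.+1.
    by rewrite trajectSr -iterSr /= yE.
  exact: fpath_traject.
(* A period of 3 or more would be a cycle in the tree; period 1 is excluded by [fE]. *)
have m2 : n - k <= 2.
  rewrite leqNgt; apply/negP => m3.
  apply: (Tacyc (traject f y (n - k))); first by rewrite size_traject.
  apply/andP; split=> //.
  by apply: sub_cycle yC => a b /eqP <-; case: (fP a).
have fE t : f t != t.
  by have [tt _] := fP t; apply: contraTneq tt => ->; rewrite edge_irrefl.
have [yfy [i iP]] := fP y; have [_ [j jP]] := fP (f y).
have ffy : f (f y) = y.
  move: yE m2; have : 0 < n - k by rewrite subn_gt0.
  case: (n - k) => [//|[|[|]]] //= _ fy _.
  by have := fE y; rewrite fy eqxx.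
(* The bag at [s] meets both sets, so [s] lies on both sides of the edge between [y] and [f y]. *)
have [s [u [v [uB vB us vs]]]] := touching_bag (Bt i j).
have /negP[] := tree_edge_bridge (td_treeP D) yfy.
have := jP s v vB vs; rewrite ffy (eq_connect (delete_edgeC _ _)) => ys.
apply: connect_trans ys _.
by rewrite (sym_connect_sym (@delete_edge_sym _ _ _)); apply: iP uB us.
Qed.

End Bramble.

(** The strict inequality absorbs the minus one in the definition of width. *)
Lemma tree_width_bag (G : sgraph) k :
    (forall D : tree_decomposition G, exists t : td_tree D, k < #|bag t|) ->
  k <= tree_width G.
Proof.
rewrite /tree_width => H; case: ex_minnP => m /asboolP[D <-] _.
have [t kt] := H D; rewrite /td_width -ltnS.
apply: (leq_trans kt); apply: (leq_trans _ (leqSpred _)).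
exact: (leq_bigmax_cond (F := fun t => #|bag t|)).
Qed.

(** * The apex graph and its twin-width *)

Section TwinWidth.

Variable N : nat.

(* First coordinate 0 is the line of apexes; the rows are numbered from 1. *)
Definition pos (x : 'I_N.+1 * 'I_N) : nat * nat := (x.1 : nat, x.2 : nat).

(** Stated on pairs of naturals so that adjacency becomes linear arithmetic. The first clause joins
    an apex to its column, the second consecutive vertices of a row. *)
Definition apex_edge (x y : nat * nat) : bool :=
  ((x.1 == 0) != (y.1 == 0)) && (x.2 == y.2)
  || [&& 0 < x.1, x.1 == y.1 & (x.2.+1 == y.2) || (y.2.+1 == x.2)].

Definition apex_rel : rel ('I_N.+1 * 'I_N) := fun x y => apex_edge (pos x) (pos y).

Lemma apex_rel_sym : symmetric apex_rel.
Proof. by move=> x y; rewrite /apex_rel /apex_edge; apply/idP/idP; lia. Qed.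

Lemma apex_rel_irrefl : irreflexive apex_rel.
Proof. by move=> x; rewrite /apex_rel /apex_edge; lia. Qed.

Definition apex_graph : sgraph := SGraph apex_rel_sym apex_rel_irrefl.

Lemma card_apex_graph : #|apex_graph| = N ^ 2 + N.
Proof. by rewrite card_prod !card_ord mulSn addnC -mulnn. Qed.

Lemma pos_inj : injective pos.
Proof. by move=> [a b] [a' b'] [] /= /val_inj-> /val_inj->. Qed.

(** Two distinct vertices have at most one common neighbour: none for two apexes, only the row
    vertex in the apex's column for an apex and a row vertex, and one apex or one row vertex for two
    row vertices. *)
Lemma apex_graph_K22_free : ~ has_subgraph (complete_bipartite 2 2) apex_graph.
Proof.
case=> f [fI fE].
have ne u v : u != v -> pos (f u) <> pos (f v).
  by move=> uv /pos_inj/fI uv'; rewrite uv' eqxx in uv.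
have /= e00 : apex_edge _ _ := fE (inl ord0) (inr ord0) isT.
have /= e01 : apex_edge _ _ := fE (inl ord0) (inr ord_max) isT.
have /= e10 : apex_edge _ _ := fE (inl ord_max) (inr ord0) isT.
have /= e11 : apex_edge _ _ := fE (inl ord_max) (inr ord_max) isT.
have n0 := ne (inl ord0) (inl ord_max) isT.
have n1 := ne (inr ord0) (inr ord_max) isT.
move: e00 e01 e10 e11 n0 n1; rewrite /apex_edge.
case: (pos _) => a a'; case: (pos _) => b b'.
case: (pos _) => c c'; case: (pos _) => d d' /=.
move=> e00 e01 e10 e11 n0 n1.
have {}n0 : (a != d) || (a' != d') by apply/negP => H; apply: n0; congr (_, _); lia.
have {}n1 : (b != c) || (b' != c') by apply/negP => H; apply: n1; congr (_, _); lia.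
lia.
Qed.

(* Rows 1, ..., [i] and the first [j] vertices of row [i.+1] are merged into row 1. *)
Definition row_label (i j : nat) (x : nat * nat) : nat * nat :=
  (if (0 < x.1) && ((x.1 <= i) || (x.1 == i.+1) && (x.2 < j)) then 1 else x.1, x.2).

(* Rows are merged, and the first [t.+1] vertices in the order
   apex 0, row vertex 0, apex 1, row vertex 1, ... are merged into apex 0. *)
Definition comb_label (t : nat) (x : nat * nat) : nat * nat :=
  if x.2.*2 + (0 < x.1) <= t then (0, 0) else (0 < x.1 : nat, x.2).

Lemma row_label_pos i j x : (0 < (row_label i j x).1) = (0 < x.1).
Proof. by rewrite /row_label /=; case: ifP => // /andP[->]. Qed.

Lemma row_label_red_bounded i j : 0 < i ->
  red_bounded (G := apex_graph) 3 (row_label i j \o pos).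
Proof.
move=> i0 x /=; case Ex: (pos x) => [r c].
(* The third label occurs at the merging front only. For [c = 0] the truncated [c.-1] merely adds a
   harmless label. *)
pose s := if (row_label i j (r, c)).1 == 1 then [:: (1, c.-1); (1, c.+1); (i.+1, c.+1)]
  else [:: row_label i j (r, c.-1); row_label i j (r, c.+1)].
exists s; first by rewrite /s; case: ifP.
move=> y _ [x1 [y1 [/= Hx1 Hy1 E1]]] [x2 [y2 [/= Hx2 Hy2 E2]]].
have {}E1 : apex_edge (pos x1) (pos y1) by [].
have {}E2 : ~~ apex_edge (pos x2) (pos y2) by [].
rewrite Ex in Hx1 Hx2; move: E1 E2 Hx1 Hx2 Hy1 Hy2.
case: (pos y) => r' c'; case: (pos x1) => a b; case: (pos y1) => a' b'.
case: (pos x2) => e f; case: (pos y2) => e' f' E1 E2 Hx1 Hx2 Hy1 Hy2.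
have [? ?] : b = c /\ b' = c' by case: Hx1 Hy1 => _ -> [_ ->].
have [? ?] : f = c /\ f' = c' by case: Hx2 Hy2 => _ -> [_ ->].
subst b b' f f'.
have := row_label_pos i j (a, c); rewrite Hx1 row_label_pos /= => a0.
have := row_label_pos i j (a', c'); rewrite Hy1 row_label_pos /= => a'0.
have := row_label_pos i j (e, c); rewrite Hx2 row_label_pos /= => e0.
have := row_label_pos i j (e', c'); rewrite Hy2 row_label_pos /= => e'0.
(* Labels preserve the column and whether a vertex is an apex, so an apex edge at one pair of
   representatives is one at every pair; only row edges can be red. *)
have /and3P[ap /eqP ? cc] : [&& 0 < a, a == a' & (c' == c.+1) || (c == c'.+1)].
  by move: E1 E2; rewrite /apex_edge /=; lia.
subst a'; rewrite -Hy1 /s {s}.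
case: eqP => [l1|l1].
  move: l1; rewrite -Hx1 /row_label ap /=; case: ifP => [H _|H a1].
    by case: ifP => H'; rewrite !inE !xpair_eqE; lia.
  by move: H; rewrite a1 i0.
suff -> : r = a by case/orP: cc => /eqP ->; rewrite !inE eqxx ?orbT.
move: l1; rewrite /row_label /=; case: ifP => // H _.
by case: Hx1; rewrite /row_label /= H; case: ifP => // H' ra; move: H; rewrite -ra i0.
Qed.

(** The total degree is at most 3 outright: a spine vertex sees its two spine neighbours and its
    apex, some of which may be the swallowed blob. *)
Lemma comb_label_red_bounded t :
  red_bounded (G := apex_graph) 3 (comb_label t \o pos).
Proof.
move=> x /=; case Ex: (pos x) => [r c].
(* The blob has one neighbour at most, the first spine vertex not yet swallowed, in column
   [uphalf t]. *)
pose s := if c.*2 + (0 < r) <= t then [:: (1, uphalf t)] else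
  if r == 0 then [:: (1, c)] else
  [:: (1, c.+1); comb_label t (1, c.-1); comb_label t (0, c)].
exists s; first by rewrite /s; do 2?case: ifP.
move=> y + [x1 [y1 [/= Hx1 Hy1 E1]]] _.
have {}E1 : apex_edge (pos x1) (pos y1) by [].
rewrite -{}Hy1; move: E1 Hx1; rewrite Ex {}/s.
case: (pos x1) => a b; case: (pos y1) => a' b' E1.
rewrite /comb_label /=; case: ifP => H1; case: ifP => H2 //=.
- move=> _; case: ifP => H3; rewrite // inE => _.
  move: E1 H1 H3; rewrite /apex_edge /= !ltnNge uphalfE.
  case: a => [|a]; case: a' => [|a'] //=; rewrite !xpair_eqE; lia.
- by case=> r0 c0; move: H2; rewrite -r0 -c0.
- by case=> a0 b0; move: H1; rewrite a0 b0.
case=> ar bc _; subst b; move: E1 ar H1 H2; rewrite /apex_edge /=.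
case: a => [|a]; case: a' => [|a']; case: r {Ex} => [|r] //=.
- by case: ifP; rewrite !inE !xpair_eqE; lia.
- by rewrite orbF => /eqP <- _ _; rewrite !inE eqxx !orbT.
move=> /andP[_ /orP[] /eqP <-] _ _; last by rewrite !inE eqxx orbT.
by case: ifP; rewrite !inE !xpair_eqE; lia.
Qed.

Hypothesis N0 : 0 < N.

Lemma comb_label_contractible t : t < N.*2 ->
  contractible (G := apex_graph) 3 (comb_label t \o pos).
Proof.
have [k] := ubnPeq (N.*2.-1 - t); elim: k t => [|k IH] t kE tN.
  apply: (@contractible_const _ _ _ _ (0, 0)) => -[r c].
  have := ltn_ord c; rewrite /comb_label /= => cN.
  by rewrite ifT //; case: (0 < r); lia.
have cN : t.+1./2 < N by lia.
have bN : odd t.+1 < N.+1 by case: odd; lia.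
pose x1 : apex_graph := (ord0, Ordinal N0).
(* The next vertex to swallow, of rank [t.+1]: the parity chooses apex or spine (represented by row
   1), the half is the column. *)
pose x2 : apex_graph := (Ordinal bN, Ordinal cN).
have x1E : comb_label t (pos x1) = (0, 0) by [].
have [l2 x2E l2P] : exists2 l2, comb_label t (pos x2) = l2 &
    forall (b : bool) c, ((b : nat, c) == l2) = (c.*2 + b == t.+1).
  exists (odd t.+1 : nat, t.+1./2); first rewrite /comb_label /= ifF.
  - by case: odd.
  - by have := odd_double_half t.+1; case: odd => /=; lia.
  move=> b c; rewrite -{3}(odd_double_half t.+1) xpair_eqE.
  by case: b; case: odd; apply/idP/idP; lia.
have l20 : (0, 0) != l2 by rewrite (l2P false 0).
have step : contractible (G := apex_graph) 3 (comb_label t.+1 \o pos).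
  by apply: IH; lia.
refine (contractible_merge (x1 := x1) (x2 := x2) _ _ (comb_label_red_bounded _) step).
  by rewrite /= x1E x2E.
move=> x; rewrite /= x1E x2E; case: (pos x) => r c; rewrite /comb_label /=.
rewrite leq_eqVlt ltnS; case: (leqP (c.*2 + _) t) => H /=.
  by rewrite orbT (negPf l20).
by rewrite orbF l2P.
Qed.

Lemma row_label_contractible i : 0 < i <= N ->
  contractible (G := apex_graph) 3 (row_label i 0 \o pos).
Proof.
have [k] := ubnPeq (N - i); elim: k i => [|k IH] i kE /andP[i0 iN].
  (* With all rows merged, the comb remains, and its blob is apex 0 alone. *)
  have -> : row_label i 0 \o pos = comb_label 0 \o pos.
    apply/funext => -[r c]; rewrite /row_label /comb_label /=.
    have ri : r <= i by have := ltn_ord r; lia.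
    rewrite ri andbT; case: (posnP r) => [->|r0].
      by rewrite addn0; case: (nat_of_ord c).
    by rewrite addn1.
  by apply: comb_label_contractible; lia.
have step : contractible (G := apex_graph) 3 (row_label i N \o pos).
  have -> : row_label i N \o pos = row_label i.+1 0 \o pos.
    apply/funext => -[r c]; have := ltn_ord c; rewrite /row_label /= => cN.
    by congr (if _ then _ else _, _); apply/idP/idP; lia.
  by apply: IH; lia.
(* Inner induction on the number [j] of vertices of row [i.+1] still to be merged. *)
suff H j : j <= N -> contractible (G := apex_graph) 3 (row_label i (N - j) \o pos).
  by have := H N (leqnn N); rewrite subnn.
elim: j => [_|j IHj jN]; first by rewrite subn0.
have jN' : N - j.+1 < N by lia.
have i1N : 1 < N.+1 by lia.
have iN' : i.+1 < N.+1 by lia.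
pose x1 : apex_graph := (Ordinal i1N, Ordinal jN').
pose x2 : apex_graph := (Ordinal iN', Ordinal jN').
have x1E : row_label i (N - j.+1) (pos x1) = (1, N - j.+1) by rewrite /row_label /= i0.
have x2E : row_label i (N - j.+1) (pos x2) = (i.+1, N - j.+1).
  by rewrite /row_label /= ifF //; lia.
refine (contractible_merge (x1 := x1) (x2 := x2) _ _
  (@row_label_red_bounded i (N - j.+1) i0) (IHj (ltnW jN))).
  by rewrite /= x1E x2E xpair_eqE; lia.
move=> x; rewrite /= x1E x2E; case: (pos x) => r c; rewrite /row_label /= xpair_eqE.
have -> : N - j = (N - j.+1).+1 by lia.
move: (N - j.+1) => m; case H: ((0 < r) && ((r <= i) || (r == i.+1) && (c < m))).
  by rewrite ifT ?ifF //; lia.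
case H': ((r == i.+1) && (c == m)).
  by case/andP: H' => /eqP -> /eqP ->; rewrite ifT //; lia.
by rewrite ifF //; lia.
Qed.

Lemma apex_graph_twin_width : twin_width (trigraph_of apex_graph) <= 3.
Proof.
(* This labelling merges nothing, so the sequence starts at the graph itself. *)
apply: (@twin_width_contractible apex_graph _ 3 (row_label 1 0 \o pos)).
  move=> x y /= xy; apply: pos_inj; move: xy; rewrite /row_label.
  have E z : (0 < z.1) && ((z.1 <= 1) || (z.1 == 2) && (z.2 < 0)) = (z.1 == 1).
    by apply/idP/idP; lia.
  rewrite !E; have F (m : nat) : (if m == 1 then 1 else m) = m by case: eqP.
  by rewrite !F.
by apply: row_label_contractible.
Qed.

End TwinWidth.

(** * A bramble of order N + 1 in the apex graph *)

Section TreeWidth.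

Variable n : nat.
Let N := n.+1.
Local Notation G := (apex_graph N).

Lemma row_connected (B : {set G}) (r : 'I_N.+1) (c c' : 'I_N) : 0 < r ->
    (forall d : 'I_N, (r, d) \in B) ->
  connect [rel x y : G | [&& edge x y, x \in B & y \in B]] (r, c) (r, c').
Proof.
move=> r0 rB.
have sym := connect_within_sym B.
suff H (d : 'I_N) :
    connect [rel x y : G | [&& edge x y, x \in B & y \in B]] (r, ord0) (r, d).
  by apply: connect_trans (H c'); rewrite sym.
case: d; elim=> [|m IH] mN; first by rewrite (_ : Ordinal mN = ord0) //; apply: val_inj.
apply: connect_trans (IH (ltnW mN)) _; apply: connect1; rewrite /= !rB !andbT.
by rewrite /edge /= /apex_rel /apex_edge /= r0 !eqxx orbT.
Qed.

Definition last_apex : G := (ord0, ord_max).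

Definition row (r : 'I_N.+1) : {set G} := [set x | x.1 == r].

(** [lift ord0] skips the apex line, and [widen_ord] leaves out the last apex and the last row. *)
Definition bramble (i : option (option ('I_n * 'I_n))) : {set G} :=
  match i with
  | None => [set last_apex]
  | Some None => row ord_max
  | Some (Some (i, j)) =>
      (ord0, widen_ord (leqnSn n) j) |: row (lift ord0 (widen_ord (leqnSn n) i))
  end.

Lemma apex_edge_row (r : 'I_N.+1) (c : 'I_N) : 0 < r -> edge ((ord0, c) : G) (r, c).
Proof. by rewrite lt0n /edge /= /apex_rel /apex_edge /= !eqxx => /negPf ->. Qed.

Lemma bramble_connected i : connected_set (bramble i).
Proof.
case: i => [[[i j]|]|] u v /=.
- set r := lift _ _; set B : {set G} := _ |: _ => uB vB.
  have rB d : (r, d) \in B by rewrite !inE eqxx orbT.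
  have sym := connect_within_sym B.
  pose c := widen_ord (leqnSn n) j.
  suff H w : w \in B ->
      connect [rel x y : G | [&& edge x y, x \in B & y \in B]] w (r, c).
    by apply: connect_trans (H u uB) _; rewrite sym; apply: H.
  case: w => wr wc; rewrite 2!inE => /orP[/eqP [-> ->]|].
    apply/connect1/and3P; split; [exact: apex_edge_row| |exact: rB].
    by rewrite !inE eqxx.
  by rewrite inE /= => /eqP ->; apply: row_connected.
- case: u v => ur uc [vr vc]; rewrite !inE /= => /eqP -> /eqP ->.
  by apply: row_connected => // d; rewrite inE.
- by rewrite !inE => /eqP -> /eqP ->; apply: connect0.
Qed.

Lemma bramble_touching i j : touching (bramble i) (bramble j).
Proof.
have apex_row k : touching (bramble None) (row (lift ord0 k)).
  exists last_apex, (lift ord0 k, ord_max); rewrite !inE !eqxx.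
  by split=> //; right; apply: apex_edge_row.
(* Each apex has a neighbour in every row, so a set with an apex touches any set containing a
   row. *)
have touching_row k l k' (B : {set G}) : row (lift ord0 k') \subset B ->
    touching (bramble (Some (Some (k, l)))) B.
  move=> /subsetP kB; pose c := widen_ord (leqnSn n) l.
  exists (ord0, c), (lift ord0 k', c); rewrite !inE eqxx; split=> //.
    by apply: kB; rewrite inE.
  by right; apply: apex_edge_row.
have maxE : ord_max = lift ord0 (ord_max : 'I_N) by apply: val_inj.
have touchingS (B B' C : {set G}) : touching B B' -> B' \subset C -> touching B C.
  by move=> [u [v [uB vB' uv]]] /subsetP BC; exists u, v; split=> //; apply: BC.
case: i j => [[[i j]|]|] [[[k l]|]|].
- exact: touching_row (subsetUr _ _).
- by apply: (touching_row _ _ ord_max); rewrite -maxE.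
- by apply/touching_sym/touchingS; [apply: apex_row|apply: subsetUr].
- by apply/touching_sym/(touching_row _ _ ord_max); rewrite -maxE.
- by exists (ord_max, ord_max), (ord_max, ord_max); rewrite !inE; split=> //; left.
- by apply/touching_sym; rewrite /bramble maxE; apply: apex_row.
- by apply: touchingS; [apply: apex_row|apply: subsetUr].
- by rewrite [bramble (Some None)]/bramble maxE; apply: apex_row.
- by exists last_apex, last_apex; rewrite !inE; split=> //; left.
Qed.

(** Either [X] meets every row, and with the last apex has N + 1 distinct first coordinates; or it
    misses a row, so it contains all N apexes besides its vertex [u] in the last row. *)
Lemma bramble_cover (X : {set G}) :
  (forall i, exists2 u, u \in bramble i & u \in X) -> N < #|X|.
Proof.
move=> cov.
have lastX : last_apex \in X by have [u] := cov None; rewrite inE => /eqP->.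
have [u urow uX] := cov (Some None).
have [allr|] := boolP [forall i : 'I_n,
    [exists x in X, x.1 == lift ord0 (widen_ord (leqnSn n) i)]].
  rewrite -[N.+1]card_ord -cardsT; apply: leq_trans (leq_imset_card fst X).
  apply/subset_leq_card/subsetP => r _; apply/imsetP.
  have [r0|r0] := posnP r.
    by exists last_apex => //; apply: val_inj.
  have [rn|rn] := eqVneq (r : nat) N.
    exists u => //; move: urow; rewrite inE => /eqP ->; exact: val_inj.
  have rn' : r.-1 < n by rewrite -ltnS prednK // ltn_neqAle rn -ltnS ltn_ord.
  have /exists_inP[x xX /eqP xr] := forallP allr (Ordinal rn').
  by exists x => //; rewrite xr; apply: val_inj; rewrite /= /bump /= add1n prednK.
rewrite negb_forall => /existsP[i /exists_inPn ri].
have allv (c : 'I_N) : (ord0, c) \in X.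
  have [cn|cn] := eqVneq (c : nat) n.
    by rewrite (_ : c = ord_max) //; apply: val_inj.
  have cn' : c < n by rewrite ltn_neqAle cn -ltnS ltn_ord.
  (* Since row [i] is missed, this element can only be hit in its apex. *)
  have [x] := cov (Some (Some (i, Ordinal cn'))).
  rewrite 2!inE => /orP[/eqP -> |].
    by rewrite (_ : widen_ord _ _ = c) //; apply: val_inj.
  by rewrite inE => xi /ri; rewrite xi.
pose A : {set G} := [set ((ord0, c) : G) | c : 'I_N].
have cA : #|A| = N by rewrite card_imset ?card_ord // => a b [].
have uA : u \notin A.
  by apply/imsetP => -[c _ uc]; move: urow; rewrite inE uc.
have <- : #|u |: A| = N.+1 by rewrite cardsU1 uA cA.
apply/subset_leq_card/subsetP => x; rewrite !inE => /orP[/eqP->//|/imsetP[c _ ->]].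
exact: allv.
Qed.

Lemma apex_graph_tree_width : N <= tree_width G.
Proof.
apply: tree_width_bag => D.
have [t tP] := bramble_bag D bramble_connected bramble_touching.
by exists t; apply: bramble_cover.
Qed.

End TreeWidth.

Theorem lemma3p7 (N : nat) (hN : 0 < N) :
  exists G : sgraph,
    [/\ #|G| = N ^ 2 + N,
        ~ has_subgraph (complete_bipartite 2 2) G,
        twin_width (trigraph_of G) <= 3 &
        N <= tree_width G].
Proof.
exists (apex_graph N); split.
- exact: card_apex_graph.
- exact: apex_graph_K22_free.
- exact: apex_graph_twin_width.
- by case: N hN => // n _; apply: apex_graph_tree_width.
Qed.
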